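(* Let $\mathcal Y$ be a finite alphabet, and let $Q_1,Q_2$ be any probability distributions on $\mathcal Y$ with $p(x,Q_1)>0$ and $p(x,Q_2)>0$ for all $x\in\mathcal X$. Then $$|\tilde b(Q_1)-\tilde b(Q_2)|\le\mu(Q_1,Q_2),\qquad\text{where}\qquad \mu(Q_1,Q_2)=\max_{x\in\mathcal X}\left|\log\frac{p(x,Q_1)}{p(x,Q_2)}\right|.$$
   Context: $\mathcal X$ is a source alphabet with a probability distribution $P_X$, $\rho:\mathcal X\times\mathcal Y\to\mathbb R$ is a (measurable) distortion measure, $d$ is a distortion level, and $\log$ is the natural logarithm. $p(x,Q)=\mathbb P_{Y\sim Q}[\rho(x,Y)\le d]=\sum_{y\in\mathcal Y:\rho(x,y)\le d}Q(y)$. A codebook is an infinite sequence $\mathcal C=(y(1),y(2),\dots)$ in $\mathcal Y$; $\mathcal C\sim Q$ means its codewords are IID from $Q$. $J(x,\mathcal C)=\inf\{j\ge1:\rho(x,y(j))\le d\}$ is the index of the first $d$-match, and $\tilde b(Q)=\mathbb E_{X\sim P_X,\mathcal C\sim Q}[\log J(X,\mathcal C)]$ with $X$ and $\mathcal C$ independent. *)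

(* Defs.v *)
From HB Require Import structures.
From mathcomp Require Export all_boot all_order all_algebra.
From mathcomp Require Export all_classical all_reals all_analysis.

Set Implicit Arguments.
Unset Strict Implicit.
Unset Printing Implicit Defensive.

Import Order.TTheory GRing.Theory Num.Theory.
Import numFieldNormedType.Exports.

Local Open Scope classical_set_scope.
Local Open Scope ring_scope.

Definition is_distribution (R : realType) (Y : finType) (Q : Y -> R) : Prop :=
  (forall y, 0 <= Q y) /\ \sum_(y : Y) Q y = 1.

Definition match_prob (R : realType) (T : Type) (Y : finType)
    (rho : T -> Y -> R) (d : R) (x : T) (Q : Y -> R) : R :=
  \sum_(y : Y | rho x y <= d) Q y.

(* The codeword y(j), j >= 1, is [c j.-1]: codebooks are indexed from 0, match
   indices from 1.  The infimum is +oo when no codeword matches. *)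
Definition first_match (R : realType) (T : Type) (Y : finType)
    (rho : T -> Y -> R) (d : R) (x : T) (c : nat -> Y) : \bar R :=
  ereal_inf [set (j.+1%:R : R)%:E | j in [set j : nat | rho x (c j) <= d]].

(* Generators of the product sigma-algebra on codebooks, Y being discrete. *)
Definition codebook_cylinders (Y : finType) : set (set (nat -> Y)) :=
  [set E | exists (j : nat) (B : set Y), E = [set c | B (c j)]].

(* The codewords are random variables on the probability space (O, P) that are
   mutually independent, each with law Q.  The product rule for a general
   finite subfamily is the case where the other [B i] are [setT]. *)
Definition iid_codebook (R : realType) (dO : measure_display)
    (O : measurableType dO) (P : probability O R) (Y : finType) (Q : Y -> R)
    (C : O -> nat -> Y) : Prop :=
  [/\ forall (j : nat) (B : set Y), measurable [set w | B (C w j)],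
      forall (j : nat) (y : Y), P [set w | C w j = y] = (Q y)%:E
    & forall (n : nat) (B : nat -> set Y),
        P [set w | forall i : nat, (i < n)%N -> B i (C w i)] =
        (\prod_(i < n) P [set w | B i (C w i)])%E].

(* X ~ P_X and C ~ Q, with X independent of the whole sequence C. *)
Definition source_and_codebook (R : realType) (dX : measure_display)
    (T : measurableType dX) (PX : probability T R) (Y : finType) (Q : Y -> R)
    (dO : measure_display) (O : measurableType dO) (P : probability O R)
    (X : O -> T) (C : O -> nat -> Y) : Prop :=
  [/\ measurable_fun [set: O] X,
      forall A : set T, measurable A -> P (X @^-1` A) = PX A,
      iid_codebook P Q C
    & forall (A : set T) (E : set (nat -> Y)),
        measurable A -> <<s @codebook_cylinders Y >> E ->
        P (X @^-1` A `&` C @^-1` E) = (P (X @^-1` A) * P (C @^-1` E))%E].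

(* [lne] sends +oo to +oo, so the integral also accounts for codebooks
   without a match.  The value depends only on the joint law of (X, C). *)
Definition expected_log_match (R : realType) (T : Type) (Y : finType)
    (rho : T -> Y -> R) (d : R) (dO : measure_display) (O : measurableType dO)
    (P : probability O R) (X : O -> T) (C : O -> nat -> Y) : \bar R :=
  (\int[P]_(w in [set: O]) lne (first_match rho d (X w) (C w)))%E.

Definition log_ratios (R : realType) (T : Type) (Y : finType)
    (rho : T -> Y -> R) (d : R) (Q1 Q2 : Y -> R) : set R :=
  range (fun x : T =>
    `|ln (match_prob rho d x Q1 / match_prob rho d x Q2)|).

Definition is_maximum (R : realType) (A : set R) (m : R) : Prop :=
  A m /\ ubound A m.

(* Meaningful as a maximum only together with
   [is_maximum (log_ratios rho d Q1 Q2) (mu rho d Q1 Q2)]. *)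
Definition mu (R : realType) (T : Type) (Y : finType)
    (rho : T -> Y -> R) (d : R) (Q1 Q2 : Y -> R) : R :=
  sup (log_ratios rho d Q1 Q2).

(* Main.v *)
(* With l_j = log ((j+2)/(j+1)), log J is the sum of the l_j over the j >= 0 such
   that none of the first j+1 codewords matches, so that for a single source
   letter with match probability 1 - s, E[log J] = sum_j l_j s^(j+1).  As
   0 <= l_j <= 1/(j+1), for t <= s the difference of two such series lies between
   0 and sum_j (s^(j+1) - t^(j+1))/(j+1) = log ((1-t)/(1-s)), the log-ratio of the
   match probabilities.  The source letter enters only through its set of matching
   codewords, which takes finitely many values; averaging over it gives the bound. *)

Require Import Defs.
From mathcomp Require Import all_boot all_order all_algebra.
From mathcomp Require Import all_classical all_reals all_analysis.
From mathcomp Require Import lra.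

Set Implicit Arguments.
Unset Strict Implicit.
Unset Printing Implicit Defensive.

Import Order.TTheory GRing.Theory Num.Theory.
Import numFieldNormedType.Exports.

Local Open Scope classical_set_scope.
Local Open Scope ring_scope.

(** * Increments of the logarithm along the integers *)

Definition log_step (R : realType) (j : nat) : R := ln (j.+2%:R / j.+1%:R).

Lemma log_step_ge0 (R : realType) (j : nat) : 0 <= log_step R j.
Proof. by rewrite ln_ge0// ler_pdivlMr ?ltr0n// mul1r ler_nat. Qed.

Lemma log_step_le (R : realType) (j : nat) : log_step R j <= j.+1%:R^-1.
Proof.
have -> : log_step R j = ln (1 + j.+1%:R^-1).
  by congr ln; rewrite -[j.+2]addn1 natrD mulrDl mul1r divff// pnatr_eq0.
by apply: le_ln1Dx; rewrite (@lt_le_trans _ _ 0)// ?ltrN10// invr_ge0 ler0n.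
Qed.

Lemma sum_log_step (R : realType) (n : nat) :
  \sum_(0 <= j < n) log_step R j = ln n.+1%:R.
Proof.
rewrite (telescope_sumr_eq (fun j => ln j.+1%:R))// ?ln1 ?subr0// => j _.
by rewrite /log_step ln_div// posrE ltr0n.
Qed.

(** * Tails of the power series of -log (1 - u) *)

Section PowerSeries.
Variable R : realType.

(** The Taylor remainder of -log (1 - u) at 0 past degree [n]. Its monotonicity on [0, 1) compares
    partial sums with the logarithm, with no passage to the limit. *)
Let remainder (n : nat) (u : R) : R :=
  - ln (1 - u) - \sum_(i < n) (i.+1%:R^-1 : R) * u ^+ i.+1.

Let is_derive_remainder (n : nat) (u : R) : u < 1 ->
  is_derive u 1 (remainder n) (u ^+ n / (1 - u)).
Proof.
move=> u1.
have u10 : 0 < 1 - u by rewrite subr_gt0.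
have dln : is_derive u 1 (@ln R \o (fun v => 1 - v)) ((1 - u)^-1 * -1).
  apply: is_derive1_comp; first exact: is_derive1_ln.
  have -> : (fun v : R => 1 - v) = cst 1 - id by [].
  by apply: is_derive_eq; rewrite sub0r.
have dX (i : 'I_n) : is_derive u 1 (fun v : R => (i.+1%:R^-1 : R) * v ^+ i.+1) (u ^+ i).
  rewrite (_ : (fun v => _) = (i.+1%:R^-1 : R) *: (@id R ^+ i.+1)); last first.
    by apply/funext => v; rewrite /= fctE.
  apply: is_derive_eq; rewrite /= -[_ *: 1]/(_ * 1) mulr1.
  by rewrite -[_ *: _]/(_ * _) mulrA mulVf ?mul1r// pnatr_eq0.
have -> : remainder n = - (@ln R \o (fun v => 1 - v)) -
    \sum_(i < n) (fun v : R => (i.+1%:R^-1 : R) * v ^+ i.+1).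
  by apply/funext => v; rewrite /remainder !fctE /= fct_sumE.
apply: is_derive_eq; rewrite mulrN1 opprK.
(* Geometric sum: 1/(1 - u) minus 1 + u + ... + u^(n-1) equals u^n/(1 - u). *)
have := subrX1 u n => E.
apply: (@mulIf _ (1 - u)); first by rewrite gt_eqF.
rewrite mulrBl mulVf ?gt_eqF// divfK ?gt_eqF//.
by lra.
Qed.

(** The derivative u^n/(1 - u) is nonnegative on [t, s], so the remainder at [t] is at most the one
    at [s]; rearranging gives the bound. *)
Lemma sum_pow_div_le_ln (n : nat) (s t : R) : 0 <= t -> t <= s -> s < 1 ->
  \sum_(0 <= j < n) (s ^+ j.+1 - t ^+ j.+1) / j.+1%:R <= ln ((1 - t) / (1 - s)).
Proof.
move=> t0 ts s1.
have : remainder n t <= remainder n s.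
  have dr u : u < 1 -> derivable (remainder n) u 1.
    by move=> /(is_derive_remainder n) [].
  apply: (@ger0_derive1_le_cc _ _ t s) => //; rewrite ?in_itv/= ?lexx ?ts//.
  - by move=> u; rewrite in_itv/= => /andP[_ us]; apply: dr; exact: lt_trans us s1.
  - move=> u; rewrite in_itv/= => /andP[tu us].
    have u1 := lt_trans us s1.
    rewrite derive1E; have [_ ->] := is_derive_remainder n u1.
    by rewrite divr_ge0 ?exprn_ge0 ?subr_ge0 ?ltW// (le_lt_trans t0 tu).
  - apply: derivable_within_continuous => u; rewrite in_itv/= => /andP[_ us].
    by apply: dr; exact: le_lt_trans us s1.
rewrite /remainder ln_div ?posrE ?subr_gt0 ?(le_lt_trans ts)//.
have -> : \sum_(0 <= j < n) (s ^+ j.+1 - t ^+ j.+1) / j.+1%:R =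
    \sum_(i < n) (i.+1%:R^-1 : R) * s ^+ i.+1 -
    \sum_(i < n) (i.+1%:R^-1 : R) * t ^+ i.+1.
  by rewrite big_mkord -sumrB; apply: eq_bigr => i _; rewrite mulrC mulrBr.
lra.
Qed.

End PowerSeries.

Lemma sum_log_step_pow (R : realType) (n : nat) (s t m : R) :
  0 <= s < 1 -> 0 <= t < 1 -> 0 <= m -> ln ((1 - t) / (1 - s)) <= m ->
  \sum_(0 <= j < n) log_step R j * s ^+ j.+1 <=
  \sum_(0 <= j < n) log_step R j * t ^+ j.+1 + m.
Proof.
move=> /andP[s0 s1] /andP[t0 t1] m0 stm.
rewrite -lerBlDl -sumrB.
(* For t <= s each increment is replaced by its bound 1/(j+1); for s <= t the difference is already
   nonpositive, and [0 <= m] concludes. *)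
have [ts|/ltW st] := leP t s.
  apply: le_trans stm; apply: le_trans (sum_pow_div_le_ln n t0 ts s1).
  apply: ler_sum => j _; rewrite -mulrBr mulrC ler_wpM2l ?log_step_le//.
  by rewrite subr_ge0 lerXn2r ?nnegrE.
apply: le_trans m0; apply: sumr_le0 => j _; rewrite -mulrBr.
by rewrite mulr_ge0_le0 ?log_step_ge0// subr_le0 lerXn2r ?nnegrE.
Qed.

(** * Expansion of log J over the no-match events *)

Definition unmatched (Y : finType) (S : {set Y}) (n : nat) : set (nat -> Y) :=
  [set c | forall i, (i < n)%N -> c i \notin S].

Definition match_set (R : realType) (T : Type) (Y : finType)
    (rho : T -> Y -> R) (d : R) (x : T) : {set Y} := [set y | rho x y <= d]%SET.

Lemma match_probE (R : realType) (T : Type) (Y : finType)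
    (rho : T -> Y -> R) (d : R) (x : T) (Q : Y -> R) :
  match_prob rho d x Q = \sum_(y in match_set rho d x) Q y.
Proof. by apply: eq_bigl => y; rewrite inE. Qed.

(** If the first match has 0-based index [k], the indicators keep exactly the increments with j < k,
    which telescope to log (k+1). With no match every increment stays and the series diverges, in
    agreement with [lne] at [+oo]. *)
Lemma lne_first_match (R : realType) (T : Type) (Y : finType)
    (rho : T -> Y -> R) (d : R) (x : T) (c : nat -> Y) :
  (lne (first_match rho d x c) =
  \sum_(0 <= j <oo) (log_step R j)%:E *
    (\1_(unmatched (match_set rho d x) j.+1) c)%:E)%E.
Proof.
pose u j := ((log_step R j)%:E *
  (\1_(unmatched (match_set rho d x) j.+1) c)%:E)%E.
rewrite -[RHS]/(\sum_(0 <= j <oo) u j)%E.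
have u0 j : (0 <= u j)%E by rewrite mule_ge0 ?lee_fin ?log_step_ge0.
have [[k0 mk0]|nomatch] := pselect (exists k, rho x (c k) <= d).
- have exm : exists k, rho x (c k) <= d by exists k0.
  case: (ex_minnP exm) => k mk kmin.
  have -> : first_match rho d x c = (k.+1%:R : R)%:E.
    apply/eqP; rewrite eq_le; apply/andP; split.
      by apply: ereal_inf_lbound; exists k.
    apply: le_ereal_inf_tmp => _ [j mj <-].
    by rewrite lee_fin ler_nat ltnS; exact: kmin.
  rewrite lne_EFin ?ltr0n// (nneseries_split 0 k) => [|j _]; last exact: u0.
  rewrite add0n [X in (_ + X)%E]eseries0 ?adde0; last first.
    (* For j >= k the matching codeword [c k] is among the first j+1, so the term vanishes. *)
    move=> j kj _; rewrite /u indicE memNset ?mule0// => /(_ k).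
    by rewrite ltnS kj inE mk => /(_ isT).
  rewrite -(sum_log_step R k) -sumEFin; apply: eq_big_nat => j /andP[_ jk].
  rewrite /u indicE mem_set ?mule1// => i ij; rewrite inE.
  apply/negP => /kmin; rewrite leqNgt (leq_trans _ jk)//.
- have -> : first_match rho d x c = +oo%E.
    rewrite /first_match (_ : [set j | _] = set0) ?image_set0 ?ereal_inf0//.
    by rewrite -subset0 => j mj; apply: nomatch; exists j.
  apply/esym/eqyP => A A0.
  (* Chosen so that exp A < n+1: the partial sum log (n+1) then exceeds [A]. *)
  pose n := Num.truncn (expR A).
  apply: (@le_trans _ _ (\sum_(0 <= j < n) u j)%E); last first.
    by apply: nneseries_lim_ge => j _ _; exact: u0.
  rewrite (eq_bigr (fun j => (log_step R j)%:E)); last first.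
    move=> j _; rewrite /u indicE mem_set ?mule1// => i _; rewrite inE.
    by apply/negP => m; apply: nomatch; exists i.
  rewrite sumEFin lee_fin sum_log_step -[leLHS]expRK ler_ln ?posrE ?expR_gt0 ?ltr0n//.
  by rewrite ltW// truncnS_gt.
Qed.

(** Finite additivity over the fibers of [f]. Measurability of [A] is part of the conclusion because
    events coupling the letter and the codebook are understood only fiber by fiber. *)
Lemma measure_fin_fibers (R : realType) (dO : measure_display)
    (O : measurableType dO) (P : probability O R) (I : finType)
    (f : O -> I) (A : set O) :
  (forall i, measurable (A `&` f @^-1` [set i])) ->
  measurable A /\ P A = (\sum_(i : I) P (A `&` f @^-1` [set i]))%E.
Proof.
move=> mA.
have EA : A = \bigcup_(i in [set: I]) (A `&` f @^-1` [set i]).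
  by rewrite seteqP; split=> [w Aw|w [i _ []//]]; exists (f w).
split.
  by rewrite EA; apply: fin_bigcup_measurable => // i _; exact: finite_finset.
rewrite {1}EA measure_fin_bigcup//; last 2 first.
- exact: finite_finset.
- by move=> i j _ _ [w [[_ <-] [_ <-]]].
have -> : [set: I] = [set` index_enum I].
  by rewrite seteqP; split=> // i _; rewrite /= mem_index_enum.
by rewrite -fsbig_seq ?index_enum_uniq.
Qed.

(** Independence of source and codebook is granted only for events in the sigma-algebra generated by
    cylinders. *)
Lemma unmatched_cylinder (Y : finType) (S : {set Y}) (n : nat) :
  <<s @codebook_cylinders Y >> (unmatched S n).
Proof.
(* The bound i < n sits inside the coordinate condition, so cylinders with i >= n are empty and a
   countable union suffices. *)
have -> : unmatched S n =
    [set: nat -> Y] `\` \bigcup_i [set c | [set y | (i < n)%N && (y \in S)] (c i)].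
  rewrite seteqP; split=> [c nc|c [_ nc] i ilt].
    by split=> // -[i _ /= /andP[/nc /negP]].
  by apply/negP => iS; apply: nc; exists i => //=; rewrite ilt.
apply: sigma_algebraCD; apply: sigma_algebra_bigcup => i.
by apply: sub_sigma_algebra; exists i, [set y | (i < n)%N && (y \in S)].
Qed.

(** * No-match probabilities of an IID codebook *)

Section Codebook.
Variables (R : realType) (dO : measure_display) (O : measurableType dO).
Variables (P : probability O R) (Y : finType) (Q : Y -> R) (C : O -> nat -> Y).
Hypothesis iidC : iid_codebook P Q C.

Let measurable_codeword (j : nat) (B : set Y) : measurable [set w | B (C w j)].
Proof. by case: iidC. Qed.

Lemma measurable_unmatched (S : {set Y}) (n : nat) :
  measurable (C @^-1` unmatched S n).
Proof.
have -> : C @^-1` unmatched S n =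
    \bigcap_(i in `I_n) [set w | [set y | y \notin S] (C w i)] by [].
by apply: fin_bigcap_measurable => [|i _]; [exact: finite_II|].
Qed.

Hypothesis Q_distr : is_distribution Q.

Lemma codeword_notin (S : {set Y}) (i : nat) :
  P [set w | C w i \notin S] = (1 - \sum_(y in S) Q y)%:E.
Proof.
have [_ lawC _] := iidC.
(* Partition by the value of the codeword: each piece is again an event on the single codeword
   [C w i]. *)
have EC y : [set w | C w i \notin S] `&` (fun w => C w i) @^-1` [set y] =
    [set w | [set z | z \notin S /\ z = y] (C w i)] by [].
have [_ ->] := measure_fin_fibers P (f := fun w => C w i) (A := [set w | C w i \notin S])
  (fun y => ltac:(rewrite EC; exact: measurable_codeword)).
rewrite (eq_bigr (fun y => (if y \notin S then Q y else 0)%:E)) => [|y _]; last first.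
  case: ifPn => yS.
    rewrite -(lawC i y); congr (P _); rewrite seteqP.
    by split=> [w [_]//|w /= wy]; split=> //=; rewrite wy.
  rewrite -[RHS](measure0 P); congr (P _); rewrite -subset0 => w [/= + wy].
  by rewrite wy (negbTE yS).
rewrite sumEFin -big_mkcond/=; congr EFin.
case: Q_distr => _ <-; rewrite [in RHS](bigID (mem S))/= addrAC subrr add0r.
by apply: eq_bigl.
Qed.

Lemma codebook_unmatched (S : {set Y}) (n : nat) :
  P (C @^-1` unmatched S n) = ((1 - \sum_(y in S) Q y) ^+ n)%:E.
Proof.
have [_ _ /(_ n (fun=> [set y | y \notin S]))] := iidC.
rewrite /= => ->.
rewrite (eq_bigr (fun=> (1 - \sum_(y in S) Q y)%:E)) => [|i _]; last first.
  exact: codeword_notin.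
by rewrite prodEFin prodr_const card_ord.
Qed.

End Codebook.

(** * Expected log J as a series averaged over match sets *)

Section ExpectedLogMatch.
Variables (R : realType) (dX : measure_display) (T : measurableType dX).
Variables (PX : probability T R) (Y : finType) (rho : T -> Y -> R) (d : R).
Hypothesis rho_meas : forall y, measurable_fun [set: T] (fun x => rho x y).

Lemma measurable_match_set (S : {set Y}) :
  measurable (match_set rho d @^-1` [set S]).
Proof.
(* Fixing the match set amounts to prescribing, for each of the finitely many [y], the truth value
   of [rho x y <= d]. *)
have -> : match_set rho d @^-1` [set S] =
    \bigcap_(y in [set: Y]) [set x | (rho x y <= d) = (y \in S)].
  rewrite seteqP; split=> [x <- y _|x xS]; first by rewrite /= inE.
  by apply/setP => y; rewrite inE; exact: xS.
apply: fin_bigcap_measurable => [|y _]; first exact: finite_finset.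
have mle : measurable_fun [set: T] (fun x => rho x y <= d).
  by apply: measurable_realfun.measurable_fun_ler => //; exact: measurable_cst.
rewrite -[X in measurable X]setTI.
exact: (mle measurableT [set y \in S]).
Qed.

(** The law of the match set of a letter drawn from [PX], as a real mass function on the subsets of
    [Y]. *)
Definition match_set_weight (S : {set Y}) : R :=
  fine (PX (match_set rho d @^-1` [set S])).

Lemma match_set_weight_ge0 (S : {set Y}) : 0 <= match_set_weight S.
Proof. by rewrite fine_ge0. Qed.

Let weightE (S : {set Y}) :
  PX (match_set rho d @^-1` [set S]) = (match_set_weight S)%:E.
Proof. by rewrite fineK// fin_num_measure//; exact: measurable_match_set. Qed.

Lemma sum_match_set_weight : \sum_S match_set_weight S = 1.
Proof.
have [|_ EPX] := measure_fin_fibers PX (f := match_set rho d) (A := [set: T]).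
  by move=> S; rewrite setTI; exact: measurable_match_set.
apply: EFin_inj; rewrite -sumEFin.
apply: etrans (etrans (esym EPX) (probability_setT PX)).
by apply: eq_bigr => S _; rewrite setTI -weightE.
Qed.

(** Carries hypotheses on letters, such as positive match probability, over to every subset that
    contributes to the average. *)
Lemma match_set_weight_neq0 (S : {set Y}) :
  match_set_weight S != 0 -> exists x, match_set rho d x = S.
Proof.
apply: contraNP => nx; rewrite /match_set_weight (_ : _ @^-1` _ = set0) ?measure0//.
by rewrite -subset0 => x /= xS; apply: nx; exists x.
Qed.

Variables (Q : Y -> R) (dO : measure_display) (O : measurableType dO).
Variables (P : probability O R) (X : O -> T) (C : O -> nat -> Y).
Hypothesis Q_distr : is_distribution Q.
Hypothesis XC : source_and_codebook PX Q P X C.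

(** Once the match set is fixed to [S], the event splits into a condition on [X] and one on [C];
    independence gives the product of probabilities, summed over [S]. *)
Lemma source_and_codebook_unmatched (n : nat) :
  let A := [set w | unmatched (match_set rho d (X w)) n (C w)] in
  measurable A /\
  P A = (\sum_S match_set_weight S * (1 - \sum_(y in S) Q y) ^+ n)%:E.
Proof.
move=> A; have [mX lawX iidC indep] := XC.
have EA S : A `&` (match_set rho d \o X) @^-1` [set S] =
    X @^-1` (match_set rho d @^-1` [set S]) `&` C @^-1` unmatched S n.
  rewrite seteqP; split=> [w [Aw wS]|w [wS Cw]].
    by split=> //; rewrite -wS.
  by split=> //; rewrite /A /= wS.
have [|mA ->] := measure_fin_fibers P (f := match_set rho d \o X) (A := A).
  move=> S; rewrite EA; apply: measurableI; last exact: measurable_unmatched iidC _ _.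
  by rewrite -[X in measurable X]setTI; apply: mX => //; exact: measurable_match_set.
split=> //; rewrite -sumEFin; apply: eq_bigr => S _.
rewrite EA indep; [|exact: measurable_match_set|exact: unmatched_cylinder].
rewrite lawX; last exact: measurable_match_set.
by rewrite weightE (codebook_unmatched iidC).
Qed.

(** The expansion of log J has nonnegative terms, so it integrates termwise, each indicator becoming
    the probability of no match among the first j+1 codewords. *)
Lemma expected_log_matchE :
  expected_log_match rho d P X C =
  (\sum_(0 <= j <oo) (log_step R j *
    \sum_S match_set_weight S * (1 - \sum_(y in S) Q y) ^+ j.+1)%:E)%E.
Proof.
pose A n := [set w | unmatched (match_set rho d (X w)) n (C w)].
have mA n : measurable (A n) by have [] := source_and_codebook_unmatched n.
have PA n : P (A n) =
    (\sum_S match_set_weight S * (1 - \sum_(y in S) Q y) ^+ n)%:E.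
  exact: (source_and_codebook_unmatched n).2.
rewrite /expected_log_match.
under eq_integral => w _.
  rewrite lne_first_match.
  rewrite (_ : (\sum_(0 <= j <oo) _)%E =
    (\sum_(0 <= j <oo) (log_step R j)%:E * (\1_(A j.+1) w)%:E)%E)//.
  over.
rewrite integral_nneseries//; last 2 first.
- move=> j; apply: measurable_funeM.
  apply/measurable_realfun.measurable_EFinP.
  exact: measurable_realfun.measurable_indic.
- by move=> j w _; rewrite mule_ge0 ?lee_fin ?log_step_ge0.
apply: eq_eseriesr => j _.
rewrite ge0_integralZl_EFin ?log_step_ge0//; last first.
  apply/measurable_realfun.measurable_EFinP.
  exact: measurable_realfun.measurable_indic.
by rewrite integral_indic// setIT EFinM; congr (_ * _)%E; exact: PA.
Qed.

End ExpectedLogMatch.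

(** The one-letter comparison is averaged on partial sums, where the sums over [i] and [j] can be
    exchanged. Conditions are imposed only where [w i != 0], since a subset that is no letter's
    match set may have zero match probability. *)
Lemma weighted_log_match_le (R : realType) (I : finType) (w s t : I -> R) (m : R) :
  (forall i, 0 <= w i) -> \sum_i w i = 1 -> 0 <= m ->
  (forall i, w i != 0 ->
    [/\ 0 <= s i < 1, 0 <= t i < 1 & ln ((1 - t i) / (1 - s i)) <= m]) ->
  (\sum_(0 <= j <oo) (log_step R j * \sum_i w i * s i ^+ j.+1)%:E <=
   \sum_(0 <= j <oo) (log_step R j * \sum_i w i * t i ^+ j.+1)%:E + m%:E)%E.
Proof.
move=> w0 w1 m0 stm.
have ge0 (u : I -> R) : (forall i, w i != 0 -> 0 <= u i) -> forall j,
    0 <= log_step R j * \sum_i w i * u i ^+ j.+1.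
  move=> u0 j; rewrite mulr_ge0 ?log_step_ge0// sumr_ge0// => i _.
  have [->|wi] := eqVneq (w i) 0; first by rewrite mul0r.
  by rewrite mulr_ge0// exprn_ge0// u0.
have s0 := ge0 s (fun i wi => let: And3 h _ _ := stm i wi in proj1 (andP h)).
have t0 := ge0 t (fun i wi => let: And3 _ h _ := stm i wi in proj1 (andP h)).
apply: lime_le.
  by apply: is_cvg_nneseries => j _ _; rewrite lee_fin.
apply: nearW => n.
apply: (@le_trans _ _ (\sum_(0 <= j < n)
    (log_step R j * \sum_i w i * t i ^+ j.+1)%:E + m%:E)%E); last first.
  by rewrite leeD2r// nneseries_lim_ge// => j _ _; rewrite lee_fin.
have swap (u : I -> R) : \sum_(0 <= j < n) log_step R j * (\sum_i w i * u i ^+ j.+1) =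
    \sum_i w i * \sum_(0 <= j < n) log_step R j * u i ^+ j.+1.
  under eq_bigr do rewrite mulr_sumr.
  rewrite exchange_big/=; apply: eq_bigr => i _.
  by rewrite mulr_sumr; apply: eq_bigr => j _; rewrite mulrCA.
rewrite !sumEFin -EFinD lee_fin !swap.
(* As the weights sum to 1, [m] is distributed as the sum of [w i * m] and the comparison is made
   for each [i]. *)
rewrite -[m]mul1r -w1 mulr_suml -big_split/=; apply: ler_sum => i _.
have [->|wi] := eqVneq (w i) 0; first by rewrite !mul0r addr0.
have [si ti sti] := stm i wi.
by rewrite -mulrDr ler_wpM2l// sum_log_step_pow.
Qed.

(** The log-ratio depends on the letter only through its match set, so it takes finitely many values
    even on an infinite source alphabet; [x0] makes the set of values nonempty. *)
Lemma mu_is_maximum (R : realType) (T : Type) (Y : finType)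
    (rho : T -> Y -> R) (d : R) (Q1 Q2 : Y -> R) (x0 : T) :
  is_maximum (log_ratios rho d Q1 Q2) (mu rho d Q1 Q2).
Proof.
pose g (S : {set Y}) := `|ln ((\sum_(y in S) Q1 y) / (\sum_(y in S) Q2 y))|.
pose realized (S : {set Y}) := `[< exists x, match_set rho d x = S >].
have r0 : realized (match_set rho d x0) by apply/asboolP; exists x0.
have gE x : `|ln (match_prob rho d x Q1 / match_prob rho d x Q2)| =
    g (match_set rho d x) by rewrite !match_probE.
have [_ /asboolP[x <-] Smax] := arg_maxP g r0.
have max_ub : ubound (log_ratios rho d Q1 Q2) (g (match_set rho d x)).
  by move=> _ [z _ <-]; rewrite gE; apply: Smax; apply/asboolP; exists z.
have max_in : log_ratios rho d Q1 Q2 (g (match_set rho d x)).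
  by exists x => //; exact: gE.
suff -> : mu rho d Q1 Q2 = g (match_set rho d x) by [].
apply/eqP; rewrite eq_le; apply/andP; split.
  by apply: ge_sup => //; exists (g (match_set rho d x)).
by apply: ub_le_sup => //; exists (g (match_set rho d x)).
Qed.

(** * Comparison of two codebook distributions *)

Section Comparison.
Variables (R : realType) (dX : measure_display) (T : measurableType dX).
Variables (PX : probability T R) (Y : finType) (rho : T -> Y -> R) (d : R).
Hypothesis rho_meas : forall y, measurable_fun [set: T] (fun x => rho x y).

Let match_prob_miss (Q : Y -> R) (x : T) :
  is_distribution Q -> 0 < match_prob rho d x Q ->
  0 <= 1 - \sum_(y in match_set rho d x) Q y < 1.
Proof.
move=> [Q0 Q1]; rewrite match_probE => p0.
rewrite subr_ge0 gtrBl p0 andbT -Q1 [leRHS](bigID (mem (match_set rho d x)))/=.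
by rewrite lerDl sumr_ge0.
Qed.

Lemma expected_log_match_ge0 (dO : measure_display) (O : measurableType dO)
    (P : probability O R) (X : O -> T) (C : O -> nat -> Y) :
  (0 <= expected_log_match rho d P X C)%E.
Proof.
apply: integral_ge0 => w _; rewrite lne_first_match; apply: nneseries_ge0 => j _ _.
by rewrite mule_ge0// lee_fin log_step_ge0.
Qed.

Lemma expected_log_match_fin_num (Q : Y -> R) (dO : measure_display)
    (O : measurableType dO) (P : probability O R) (X : O -> T)
    (C : O -> nat -> Y) :
  is_distribution Q -> (forall x, 0 < match_prob rho d x Q) ->
  source_and_codebook PX Q P X C ->
  expected_log_match rho d P X C \is a fin_num.
Proof.
move=> Q_distr p0 XC; rewrite ge0_fin_numE; last exact: expected_log_match_ge0.
rewrite (expected_log_matchE _ rho_meas Q_distr XC).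
(* The series is compared with miss probability 0, an immediate match. The sum over all subsets is a
   crude finite bound that dominates each single log-ratio. *)
pose p (S : {set Y}) := \sum_(y in S) Q y.
have := @weighted_log_match_le R _ (match_set_weight PX rho d) (fun S => 1 - p S)
  (fun=> 0) (\sum_S `|ln (p S)^-1|) (match_set_weight_ge0 PX rho d)
  (sum_match_set_weight PX d rho_meas).
have -> : (\sum_(0 <= j <oo) (log_step R j *
    \sum_S match_set_weight PX rho d S * 0 ^+ j.+1)%:E = 0)%E.
  (* The exponent j+1 is never 0, so every power of 0 vanishes. *)
  apply: eseries0 => j _ _; rewrite big1 ?mulr0// => S _.
  by rewrite expr0n mulr0.
rewrite add0e => H; apply: le_lt_trans (H _ _) (ltry _).
  exact: sumr_ge0.
move=> S /match_set_weight_neq0[x <-]; split.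
- exact: match_prob_miss.
- by rewrite lexx ltr01.
rewrite subr0 subKr div1r (le_trans (ler_norm _))//.
by rewrite (bigD1 (match_set rho d x))//= lerDl sumr_ge0.
Qed.

(** Taking s and t to be the miss probabilities under [Q1] and [Q2] makes (1 - t)/(1 - s) the ratio
    p(x, Q2)/p(x, Q1). Only this one-sided bound is needed, so that the two directions come from
    exchanging the distributions. *)
Lemma expected_log_match_le (Q1 Q2 : Y -> R) (m : R)
    (dO1 : measure_display) (O1 : measurableType dO1) (P1 : probability O1 R)
    (X1 : O1 -> T) (C1 : O1 -> nat -> Y)
    (dO2 : measure_display) (O2 : measurableType dO2) (P2 : probability O2 R)
    (X2 : O2 -> T) (C2 : O2 -> nat -> Y) :
  is_distribution Q1 -> is_distribution Q2 ->
  (forall x, 0 < match_prob rho d x Q1) ->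
  (forall x, 0 < match_prob rho d x Q2) ->
  source_and_codebook PX Q1 P1 X1 C1 -> source_and_codebook PX Q2 P2 X2 C2 ->
  0 <= m ->
  (forall x, ln (match_prob rho d x Q2 / match_prob rho d x Q1) <= m) ->
  (expected_log_match rho d P1 X1 C1 <=
   expected_log_match rho d P2 X2 C2 + m%:E)%E.
Proof.
move=> Q1_distr Q2_distr p1 p2 XC1 XC2 m0 Qm.
rewrite (expected_log_matchE _ rho_meas Q1_distr XC1).
rewrite (expected_log_matchE _ rho_meas Q2_distr XC2).
apply: weighted_log_match_le => //.
- exact: match_set_weight_ge0.
- exact: sum_match_set_weight.
move=> S /match_set_weight_neq0[x <-]; split; [exact: match_prob_miss..|].
by rewrite !subKr -!match_probE.
Qed.

End Comparison.

Theorem proposition5 (R : realType)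
  (dX : measure_display) (T : measurableType dX) (PX : probability T R)
  (Y : finType) (rho : T -> Y -> R)
  (rho_meas : forall y : Y, measurable_fun [set: T] (fun x : T => rho x y))
  (d : R) (Q1 Q2 : Y -> R)
  (Q1_distr : is_distribution Q1) (Q2_distr : is_distribution Q2)
  (p1_gt0 : forall x : T, 0 < match_prob rho d x Q1)
  (p2_gt0 : forall x : T, 0 < match_prob rho d x Q2)
  (dO1 : measure_display) (O1 : measurableType dO1) (P1 : probability O1 R)
  (X1 : O1 -> T) (C1 : O1 -> nat -> Y)
  (XC1 : source_and_codebook PX Q1 P1 X1 C1)
  (dO2 : measure_display) (O2 : measurableType dO2) (P2 : probability O2 R)
  (X2 : O2 -> T) (C2 : O2 -> nat -> Y)
  (XC2 : source_and_codebook PX Q2 P2 X2 C2) :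
  is_maximum (log_ratios rho d Q1 Q2) (mu rho d Q1 Q2) /\
  (`| expected_log_match rho d P1 X1 C1 - expected_log_match rho d P2 X2 C2 |
    <= (mu rho d Q1 Q2)%:E)%E.
Proof.
(* An empty source alphabet would have total mass 0 instead of 1. *)
have [x0 _] : [set: T] !=set0.
  apply/set0P/eqP => T0; have /eqP := oner_neq0 R; apply; apply: EFin_inj.
  by rewrite -(probability_setT PX) T0 measure0.
have mu_max := mu_is_maximum rho d Q1 Q2 x0; split=> //.
have mu_ge x : `|ln (match_prob rho d x Q1 / match_prob rho d x Q2)| <= mu rho d Q1 Q2.
  by apply: mu_max.2; exists x.
have mu0 := le_trans (normr_ge0 _) (mu_ge x0).
have fin1 := expected_log_match_fin_num rho_meas Q1_distr p1_gt0 XC1.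
have fin2 := expected_log_match_fin_num rho_meas Q2_distr p2_gt0 XC2.
have le12 : (expected_log_match rho d P1 X1 C1 <=
    expected_log_match rho d P2 X2 C2 + (mu rho d Q1 Q2)%:E)%E.
  apply: (expected_log_match_le rho_meas Q1_distr Q2_distr
    p1_gt0 p2_gt0 XC1 XC2 mu0) => x.
  apply: le_trans (mu_ge x).
  by rewrite -invf_div lnV ?posrE ?divr_gt0// -normrN ler_norm.
have le21 : (expected_log_match rho d P2 X2 C2 <=
    expected_log_match rho d P1 X1 C1 + (mu rho d Q1 Q2)%:E)%E.
  apply: (expected_log_match_le rho_meas Q2_distr Q1_distr
    p2_gt0 p1_gt0 XC2 XC1 mu0) => x.
  exact: le_trans (ler_norm _) (mu_ge x).
(* Both expectations are finite, so the two extended-real inequalities become real ones and combine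
   into the absolute value. *)
move: fin1 fin2 le12 le21.
case: (expected_log_match rho d P1 X1 C1) => // b1 _.
case: (expected_log_match rho d P2 X2 C2) => // b2 _.
rewrite -!EFinD !lee_fin => le12 le21.
by rewrite ler_norml; lra.
Qed.
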